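(* The robustness measures $M=R^{\mathbb{D}}_{\mathcal{S}_+}$ and $M=R^{\mathcal{S}_+}_{\mathcal{S}_+}$ satisfy both monotonicity and strong monotonicity under $\mathcal{O}_{\mathrm{RNG}}$. That is, for every $\rho\in\mathbb{D}$: (monotonicity) $M(\rho)\ge M(\Theta(\rho))$ for every completely positive trace-preserving $\Theta\in\mathcal{O}_{\mathrm{RNG}}$; (strong monotonicity) $M(\rho)\ge\sum_n p_n\,M\!\left(\frac{K_n\rho K_n^\dagger}{p_n}\right)$, where $p_n=\mathrm{Tr}(K_n\rho K_n^\dagger)$, for every set $\{K_n\}_n$ of Kraus operators of a quantum channel such that each map $K_n\cdot K_n^\dagger$ belongs to $\mathcal{O}_{\mathrm{RNG}}$.
   Context: Fix $d\ge 1$. $\mathcal{V}\subseteq\mathbb{C}^d$ is a nonempty compact set of unit vectors such that $|\psi\rangle\in\mathcal{V}$ implies $e^{i\theta}|\psi\rangle\in\mathcal{V}$ for all real $\theta$. $\mathbb{D}$ is the set of $d\times d$ density matrices. Put $\mathcal{S}_+=\{|v\rangle\langle v| : |v\rangle\in\mathcal{V}\}$ and let $\mathcal{S}_+^{**}=\mathbb{R}_+\mathrm{conv}(\mathcal{S}_+)$ be the convex cone it generates. For $\mathcal{X}\subseteq\mathbb{D}$ closed, the robustness is $R^{\mathcal{X}}_{\mathcal{S}_+}(\rho)=\inf\{s\in\mathbb{R}_+ : \exists\,\omega\in\mathrm{conv}(\mathcal{X}),\ \rho+s\omega\in\mathcal{S}_+^{**}\}\in[0,\infty]$, with $\inf\emptyset=\infty$;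 $\mathcal{X}=\mathcal{S}_+$ gives the standard robustness and $\mathcal{X}=\mathbb{D}$ the generalised robustness. $\mathcal{O}_{\mathrm{RNG}}$ is the set of resource non-generating operations: completely positive linear maps $\Phi$ on $d\times d$ matrices (not necessarily trace-preserving) with $\sigma\in\mathcal{S}_+^{**}\Rightarrow\Phi(\sigma)\in\mathcal{S}_+^{**}$. $\{K_n\}$ is a finite set of $d\times d$ matrices with $\sum_n K_n^\dagger K_n=\mathbb{1}$; terms with $p_n=0$ are omitted from the sum. *)

(* Defs.v *)
(* MathComp-Analysis; C is R[i] for an arbitrary R : realType. *)
From HB Require Import structures.
From mathcomp Require Import all_boot all_order all_algebra complex.
From mathcomp Require Import sesquilinear spectral.
From mathcomp Require Import all_classical all_reals all_analysis.

Set Implicit Arguments.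
Unset Strict Implicit.
Unset Printing Implicit Defensive.

Import Order.TTheory GRing.Theory Num.Theory numFieldNormedType.Exports.

Local Open Scope classical_set_scope.
Local Open Scope ring_scope.
Local Open Scope complex_scope.
Local Open Scope sesquilinear_scope.

Section QuantumObjects.
Context {R : realType}.

(* In the order of R[i], [0 <= z] says that z is real and nonnegative, so that
   [psd A] forces A to be Hermitian. *)
Definition psd {d : nat} (A : 'M[R[i]]_d) : Prop :=
  forall v : 'cV[R[i]]_d, 0 <= (v^t* *m A *m v) 0 0.

Definition density {d : nat} : set 'M[R[i]]_d :=
  [set rho | psd rho /\ \tr rho = 1].

(* The map id_k (x) Phi acts on a matrix of k x k blocks of size d x d by
   applying Phi to each block. *)
Definition completely_positive {d : nat} (Phi : 'M[R[i]]_d -> 'M[R[i]]_d) :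
  Prop :=
  forall (k : nat) (A : 'M[R[i]]_(\sum_(i < k) d)),
    psd A -> psd (\mxblock_(i < k, j < k) Phi (submxblock A i j)).

Definition trace_preserving {d : nat} (Phi : 'M[R[i]]_d -> 'M[R[i]]_d) : Prop :=
  forall A, \tr (Phi A) = \tr A.

Definition kraus_map {d : nat} (K : 'M[R[i]]_d) : 'M[R[i]]_d -> 'M[R[i]]_d :=
  fun A => K *m A *m K^t*.

(* [^o] selects the normed-module structure of R[i] over itself, from which the
   vectors inherit the usual topology of C^d. *)
Definition free_vectors {d : nat} (V : set 'cV[R[i]]_d) : Prop :=
  [/\ V !=set0,
      compact (V : set 'cV[R[i]^o]_d),
      forall v, V v -> (v^t* *m v) 0 0 = 1
    & forall v (theta : R), V v -> V ((cos theta +i* sin theta) *: v)].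

Definition free_pure {d : nat} (V : set 'cV[R[i]]_d) : set 'M[R[i]]_d :=
  [set v *m v^t* | v in V].

Definition convex_hull {d : nat} (X : set 'M[R[i]]_d) : set 'M[R[i]]_d :=
  [set A | exists (n : nat) (w : 'I_n -> R) (x : 'I_n -> 'M[R[i]]_d),
     [/\ forall i, 0 <= w i, \sum_i w i = 1, forall i, X (x i)
       & A = \sum_i (w i)%:C *: x i]].

Definition free_cone {d : nat} (V : set 'cV[R[i]]_d) : set 'M[R[i]]_d :=
  [set A | exists (t : R) (sigma : 'M[R[i]]_d),
     [/\ 0 <= t, convex_hull (free_pure V) sigma & A = t%:C *: sigma]].

(* The infimum of the empty set is +oo. *)
Definition robustness {d : nat} (V : set 'cV[R[i]]_d) (X : set 'M[R[i]]_d)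
    (rho : 'M[R[i]]_d) : \bar R :=
  ereal_inf [set s%:E | s in
    [set s : R | 0 <= s /\ exists omega,
       convex_hull X omega /\ free_cone V (rho + s%:C *: omega)]].

Definition resource_nongenerating {d : nat} (V : set 'cV[R[i]]_d) :
  set ('M[R[i]]_d -> 'M[R[i]]_d) :=
  [set Phi | [/\ linear Phi, completely_positive Phi
    & forall sigma, free_cone V sigma -> free_cone V (Phi sigma)]].

Definition resource_monotone {d : nat} (O : set ('M[R[i]]_d -> 'M[R[i]]_d))
    (M : 'M[R[i]]_d -> \bar R) : Prop :=
  forall rho, density rho ->
  forall Theta, O Theta -> trace_preserving Theta ->
    (M (Theta rho) <= M rho)%E.

(* The probabilities p n are complex numbers that happen to be real; [Re] only
   changes their type. *)
Definition strong_resource_monotone {d : nat} (O : set ('M[R[i]]_d -> 'M[R[i]]_d))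
    (M : 'M[R[i]]_d -> \bar R) : Prop :=
  forall rho, density rho ->
  forall (m : nat) (K : 'I_m -> 'M[R[i]]_d),
    \sum_n (K n)^t* *m K n = 1%:M ->
    (forall n, O (kraus_map (K n))) ->
    let p n := \tr (kraus_map (K n) rho) in
    (\sum_(n | p n != 0%R)
       (complex.Re (p n))%:E * M ((p n)^-1 *: kraus_map (K n) rho)%R
     <= M rho)%E.

End QuantumObjects.

(* Main.v *)
(* If rho + s omega lies in the free cone, applying a linear resource
   non-generating Phi gives Phi rho + s Phi omega in the free cone, and
   Phi omega = t omega' with t = Tr (Phi omega) >= 0 and omega' again in the
   convex hull of X.  Dividing by p = Tr (Phi rho), the outcome has robustness
   at most s t / p.  For a channel t = 1; for Kraus operators the weighted bounds
   s t_n add up to at most s, because the t_n sum to Tr omega = 1. *)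
Require Import Defs.
From mathcomp Require Import all_boot all_order all_algebra complex.
From mathcomp Require Import sesquilinear spectral.
From mathcomp Require Import all_classical all_reals all_analysis.

Set Implicit Arguments.
Unset Strict Implicit.
Unset Printing Implicit Defensive.

Import Order.TTheory GRing.Theory Num.Theory.

Local Open Scope classical_set_scope.
Local Open Scope ring_scope.
Local Open Scope complex_scope.
Local Open Scope sesquilinear_scope.

Section Robustness.
Context {R : realType} {d : nat}.
Implicit Types (A rho omega sigma : 'M[R[i]]_d) (V : set 'cV[R[i]]_d).
Implicit Types (X : set 'M[R[i]]_d) (Phi : 'M[R[i]]_d -> 'M[R[i]]_d).

Lemma ReK_ge0 (z : R[i]) : 0 <= z -> (complex.Re z)%:C = z.
Proof. by move=> z0; rewrite RRe_real// ger0_real. Qed.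

Lemma Re_ge0 (z : R[i]) : 0 <= z -> 0 <= complex.Re z.
Proof. by rewrite lecE => /andP[]. Qed.

Lemma delta_mx_trC (i : 'I_d) :
  (delta_mx i 0 : 'cV[R[i]]_d)^t* = delta_mx 0 i.
Proof. by apply/matrixP => k l; rewrite !mxE conjC_nat andbC. Qed.

Lemma psd_diag_ge0 A i : psd A -> 0 <= A i i.
Proof.
by move=> /(_ (delta_mx i 0)); rewrite delta_mx_trC -rowE -colE !mxE.
Qed.

Lemma psd_trace_ge0 A : psd A -> 0 <= \tr A.
Proof. by move=> Apsd; apply: sumr_ge0 => i _; exact: psd_diag_ge0. Qed.

(* The off-diagonal entries vanish by testing psd on e_i + c e_j with
   c = 1, -1, i, -i. *)
Lemma psd_trace_eq0 A : psd A -> \tr A = 0 -> A = 0.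
Proof.
move=> Apsd trA0.
have diag0 i : A i i = 0.
  apply/eqP; have /eqP := trA0; rewrite psumr_eq0 => [/allP|k _].
    by move=> /(_ i (mem_index_enum i)).
  exact: psd_diag_ge0.
have form i j (c : R[i]) : 0 <= c * A i j + c^*%R * A j i.
  have := Apsd (delta_mx i 0 + c *: delta_mx j 0).
  have -> : (delta_mx i 0 + c *: delta_mx j 0)^t*
      = delta_mx 0 i + c^*%R *: delta_mx 0 j :> 'rV[R[i]]_d.
    rewrite -!delta_mx_trC; apply/matrixP => k l.
    by rewrite !mxE rmorphD rmorphM.
  rewrite !mulmxDl !mulmxDr -!scalemxAl -!scalemxAr -!rowE -!colE !mxE.
  by rewrite !diag0 !mulr0 add0r addr0.
apply/matrixP => i j; rewrite mxE.
have sum0 (c : R[i]) : c * A i j + c^*%R * A j i = 0.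
  apply/le_anti; rewrite form andbT -oppr_ge0 opprD -!mulNr -rmorphN.
  exact: form.
have := sum0 'i%R; have := sum0 1; rewrite conjC1 !mul1r => /eqP.
rewrite addr_eq0 => /eqP ->; rewrite conjCi mulrN mulNr -opprD -mulr2n.
move/eqP; rewrite oppr_eq0 mulrn_eq0 mulf_eq0 (negPf (neq0Ci _)) /= => /eqP ->.
by rewrite oppr0.
Qed.

(** Taking [k = 1] in [completely_positive] yields plain positivity, up to this passage between a
    matrix and its single-block form. *)
Lemma psd_mxblock1 A : psd (\mxblock_(i < 1, j < 1) A) <-> psd A.
Proof.
have formE (v : 'I_1 -> 'cV[R[i]]_d) :
    ((\mxcol_i v i)^t* *m (\mxblock_(i < 1, j < 1) A) *m (\mxcol_i v i)) 0 0
    = ((v 0)^t* *m A *m v 0) 0 0.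
  have -> : (\mxcol_i v i)^t* = \mxrow_i (v i)^t*.
    by apply/matrixP => i j; rewrite !mxE.
  by rewrite mul_mxrow_mxblock mul_mxrow_mxcol !big_ord1.
split=> Apsd v; first by have := Apsd (\mxcol_(i < 1) v); rewrite formE.
by rewrite -(submxcolK v) formE.
Qed.

Lemma completely_positive_psd Phi A :
  completely_positive Phi -> psd A -> psd (Phi A).
Proof.
move=> /(_ 1%N) Phi_cp /psd_mxblock1 /Phi_cp.
under eq_mxblock do rewrite mxblockK.
by move/psd_mxblock1.
Qed.

Lemma sub_convex_hull X : X `<=` convex_hull X.
Proof.
move=> A XA; exists 1%N, (fun=> 1), (fun=> A); split=> //.
  by rewrite big_ord1.
by rewrite big_ord1 scale1r.
Qed.

Lemma convex_hull_density : convex_hull (@density R d) `<=` density.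
Proof.
move=> _ [n [w [x [w_ge0 w_sum x_dens ->]]]]; split.
  move=> v; rewrite mulmx_sumr mulmx_suml summxE; apply: sumr_ge0 => i _.
  rewrite -scalemxAr -scalemxAl mxE mulr_ge0 ?ler0c//.
  by case: (x_dens i).
rewrite raddf_sum/= -[1]/(1%:C) -w_sum rmorph_sum; apply: eq_bigr => i _.
by rewrite mxtraceZ; case: (x_dens i) => _ ->; rewrite mulr1.
Qed.

Lemma free_pure_density V : free_vectors V -> free_pure V `<=` density.
Proof.
move=> [_ _ Vunit _] _ [v Vv <-]; split.
  move=> u; rewrite mulmxA -mulmxA mxE big_ord1.
  (* The quadratic form splits into two conjugate scalars, so it is a squared modulus. *)
  have -> : (v^t* *m u) 0 0 = ((u^t* *m v) 0 0)^*%R.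
    rewrite !mxE rmorph_sum; apply: eq_bigr => k _.
    by rewrite !mxE rmorphM/= conjCK mulrC.
  exact: mul_conjC_ge0.
by rewrite mxtrace_mulC trace_mx11 Vunit.
Qed.

Lemma convex_hullS X X' : X `<=` X' -> convex_hull X `<=` convex_hull X'.
Proof.
move=> XX' _ [n [w [x [w_ge0 w_sum Xx ->]]]].
by exists n, w, x; split=> // i; exact: XX'.
Qed.

Lemma free_coneZ V (t : R) A :
  0 <= t -> free_cone V A -> free_cone V (t%:C *: A).
Proof.
move=> t0 [u [sigma [u0 Vsigma ->]]]; exists (t * u), sigma.
by rewrite mulr_ge0// scalerA rmorphM.
Qed.

(** The case [t = 0] is allowed because a map that is not trace-preserving may annihilate
    [omega]. *)
Definition stable_hull X Phi :=
  forall omega, convex_hull X omega ->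
  exists t omega', [/\ 0 <= t, convex_hull X omega' & Phi omega = t%:C *: omega'].

Lemma stable_hull_density V Phi :
  resource_nongenerating V Phi -> stable_hull density Phi.
Proof.
move=> [_ Phi_cp _] omega homega.
have [omega_psd _] := convex_hull_density homega.
have Phi_psd := completely_positive_psd Phi_cp omega_psd.
have [tr0|tr_neq0] := eqVneq (\tr (Phi omega)) 0.
  (* Here [Phi omega = 0], so any element of the hull serves as [omega']. *)
  exists 0, omega; split=> //.
  by rewrite rmorph0 scale0r; exact: psd_trace_eq0.
have tr_ge0 := psd_trace_ge0 Phi_psd.
exists (complex.Re (\tr (Phi omega))), ((\tr (Phi omega))^-1 *: Phi omega).
split; first exact: Re_ge0.
  apply: sub_convex_hull; split; last by rewrite mxtraceZ mulVf.
  by move=> v; rewrite -scalemxAr -scalemxAl mxE mulr_ge0 ?invr_ge0.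
by rewrite ReK_ge0// scalerA mulfV// scale1r.
Qed.

(** For [X = free_pure V] the conclusion unfolds to membership of [Phi omega] in the free cone, and
    [omega] lies in that cone with coefficient 1. *)
Lemma stable_hull_free V Phi :
  resource_nongenerating V Phi -> stable_hull (free_pure V) Phi.
Proof.
move=> [_ _ Phi_free] omega homega; apply: Phi_free.
by exists 1, omega; rewrite scale1r.
Qed.

Section Monotonicity.
Variables (V : set 'cV[R[i]]_d) (X : set 'M[R[i]]_d).
(** These two properties are all that the arguments use about [X], so both robustness measures are
    treated at once. *)
Hypothesis trace_hull : forall omega, convex_hull X omega -> \tr omega = 1.
Hypothesis rng_stable_hull :
  forall Phi, resource_nongenerating V Phi -> stable_hull X Phi.

Lemma robustness_le rho (s : R) omega : 0 <= s -> convex_hull X omega ->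
  free_cone V (rho + s%:C *: omega) -> (robustness V X rho <= s%:E)%E.
Proof.
move=> s0 Xomega Vrho; apply: ereal_inf_lbound.
by exists s => //; split=> //; exists omega.
Qed.

Lemma robustness_monotone :
  resource_monotone (resource_nongenerating V) (robustness V X).
Proof.
move=> rho _ Theta Theta_rng Theta_tr.
(* It suffices to bound by each feasible [s]; if there is none, the right-hand side is [+oo]. *)
apply: le_ereal_inf_tmp => _ [s [s0 [omega [Xomega Vrho]]] <-].
case: (Theta_rng) => Theta_lin _ Theta_free.
have [t [omega' [t0 Xomega' ThetaE]]] := rng_stable_hull Theta_rng Xomega.
have t1 : t%:C = 1.
  rewrite -(trace_hull Xomega) -Theta_tr ThetaE mxtraceZ.
  by rewrite (trace_hull Xomega') mulr1.
apply: (robustness_le (omega := omega')) => //.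
have := Theta_free _ Vrho.
(* [linear] speaks of [a *: u + v], so the scaled term is moved to the front and back. *)
by rewrite addrC Theta_lin ThetaE t1 scale1r addrC.
Qed.

(** The bound uses the trace of [Phi omega] instead of an existential [t], so that it can be summed
    over the Kraus maps. *)
Lemma robustness_outcome_le Phi rho omega (s : R) :
    resource_nongenerating V Phi -> 0 <= s -> convex_hull X omega ->
    free_cone V (rho + s%:C *: omega) -> 0 < \tr (Phi rho) ->
  ((complex.Re (\tr (Phi rho)))%:E
     * robustness V X ((\tr (Phi rho))^-1 *: Phi rho)%R
   <= (s * complex.Re (\tr (Phi omega)))%:E)%E.
Proof.
move=> Phi_rng s0 Xomega Vrho.
case: (Phi_rng) => Phi_lin _ Phi_free.
have [t [omega' [t0 Xomega' PhiE]]] := rng_stable_hull Phi_rng Xomega.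
have -> : complex.Re (\tr (Phi omega)) = t.
  by rewrite PhiE mxtraceZ (trace_hull Xomega') mulr1.
move: (\tr (Phi rho)) => z z_gt0.
have zE : (complex.Re z)%:C = z by rewrite ReK_ge0// ltW.
have p_gt0 : 0 < complex.Re z by rewrite -ltcR zE.
rewrite -zE /=; move: (complex.Re z) p_gt0 => p p_gt0.
(* Cancelling [p] leaves [s * t / p] as the feasible value for the normalised outcome. *)
have -> : s * t = p * (s * t / p) by rewrite [RHS]mulrC divfK// gt_eqF.
rewrite EFinM lee_pmul2l//.
apply: (robustness_le (omega := omega')) => //.
  by rewrite divr_ge0 ?mulr_ge0// ltW.
have pV_ge0 : 0 <= p^-1 by rewrite invr_ge0 ltW.
have := free_coneZ pV_ge0 (Phi_free _ Vrho).
rewrite addrC Phi_lin PhiE addrC scalerDr !scalerA.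
rewrite -[p%:C^-1](fmorphV (real_complex R)).
by rewrite [s * t / p]mulrC mulrA !rmorphM.
Qed.

Lemma robustness_strong_monotone :
  strong_resource_monotone (resource_nongenerating V) (robustness V X).
Proof.
move=> rho [rho_psd _] m K K_sum K_rng.
pose p n := \tr (kraus_map (K n) rho).
change (\sum_(n | p n != 0%R) (complex.Re (p n))%:E
  * robustness V X ((p n)^-1 *: kraus_map (K n) rho)%R
  <= robustness V X rho)%E.
apply: le_ereal_inf_tmp => _ [s [s0 [omega [Xomega Vrho]]] <-].
pose q n := complex.Re (\tr (kraus_map (K n) omega)).
have p_ge0 n : 0 <= p n.
  have [_ K_cp _] := K_rng n.
  by apply: psd_trace_ge0; exact: completely_positive_psd.
have q_ge0 n : 0 <= q n.
  have [t [omega' [t0 Xomega' KE]]] := rng_stable_hull (K_rng n) Xomega.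
  by rewrite /q KE mxtraceZ (trace_hull Xomega') mulr1.
(* Cyclicity of the trace brings the Kraus operators together as [(K n)^t* *m K n], which sum to the
   identity. *)
have q_sum : \sum_n q n = 1.
  rewrite /q -raddf_sum/= /kraus_map.
  under eq_bigr do rewrite mxtrace_mulC mulmxA.
  by rewrite -raddf_sum/= -mulmx_suml K_sum mul1mx trace_hull.
apply: (@le_trans _ _ (\sum_(n | p n != 0%R) (s * q n)%:E)%E).
  apply: lee_sum => n pn_neq0.
  by apply: robustness_outcome_le => //; rewrite lt0r pn_neq0 p_ge0.
rewrite sumEFin lee_fin -[leRHS]mulr1 -q_sum mulr_sumr.
(* Outcomes with [p n = 0] are omitted on the left but may have [q n > 0]; their terms [s * q n]
   only enlarge the right-hand side. *)
rewrite [leRHS](bigID (fun n => p n != 0))/=.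
by rewrite lerDl sumr_ge0// => n _; rewrite mulr_ge0.
Qed.

End Monotonicity.

End Robustness.

Theorem corollary18 (R : realType) (d : nat) (hd : (0 < d)%N)
    (V : set 'cV[R[i]]_d) (hV : free_vectors V) :
  (resource_monotone (resource_nongenerating V) (robustness V density) /\
   strong_resource_monotone (resource_nongenerating V)
     (robustness V density)) /\
  (resource_monotone (resource_nongenerating V)
     (robustness V (free_pure V)) /\
   strong_resource_monotone (resource_nongenerating V)
     (robustness V (free_pure V))).
Proof.
have tr_dens (omega : 'M[R[i]]_d) : convex_hull density omega -> \tr omega = 1.
  by move=> /convex_hull_density[].
(* The unit norm of the vectors in [V] enters here, making the free pure states density matrices. *)
have tr_free (omega : 'M[R[i]]_d) :
    convex_hull (free_pure V) omega -> \tr omega = 1.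
  by move/(convex_hullS (free_pure_density hV)); exact: tr_dens.
have stable_dens := @stable_hull_density R d V.
have stable_free := @stable_hull_free R d V.
split; split; [exact: robustness_monotone|exact: robustness_strong_monotone|
               exact: robustness_monotone|exact: robustness_strong_monotone].
Qed.
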